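(* Let $\mathcal H$ be a $\mathbb Z$-graded vector space over $\mathbb C$ and let $(C(\varphi)_c^{\langle\cdot\rangle},d)$ be the complex of cyclic differential forms on the formal noncommutative supermanifold of $\mathcal H$. Then the cohomology with respect to $d$ is trivial.
   Context: Let $\{e_i\}$ be a homogeneous basis of $\mathcal H$ and $\{\phi^i\}$ the dual coordinates, associative and noncommuting, with $\deg\phi^i=-\deg e_i$; write $i$ for $\deg e_i$ in exponents. Adjoin symbols $d\phi^i$ of the same degree as $\phi^i$, with an additional independent form degree $\sharp(d\phi^i)=1$, $\sharp(\phi^i)=0$. Write $\varphi^\mu$ for either $\phi^i$ or $d\phi^i$, and $\sharp_\mu=\sharp(\varphi^\mu)$. $C(\varphi)_c$ is the space of formal sums over $k\ge1$ of terms $\frac1k a_{\mu_1\cdots\mu_k}\varphi^{\mu_k}\cdots\varphi^{\mu_1}$ with $a_{\mu_1\cdots\mu_k}\in\mathbb C$ cyclic: $$a_{\mu_1\cdots\mu_k}=(-1)^{i_1(i_2+\cdots+i_k)+\sharp_{\mu_1}(\sharp_{\mu_2}+\cdots+\sharp_{\mu_k})}a_{\mu_2\cdots\mu_k\mu_1}$$ (where $\varphi^{\mu_r}$ is $\phi^{i_r}$ or $d\phi^{i_r}$). In particular there are no constant terms. $C(\varphi)_c^{\langle l\rangle}$, $l\ge0$, is the subspace of form degree $l$ (total $\sharp$ equal to $l$). The exterior derivative $d:C(\varphi)_c^{\langle l\rangle}\to C(\varphi)_c^{\langle l+1\rangle}$ is $$d\Big(\tfrac1k a_{\mu_1\cdots\mu_k}\varphi^{\mu_k}\cdots\varphi^{\mu_1}\Big)=\tfrac1k\sum_{i=1}^k(-1)^{\sharp_{\mu_1}+\cdots+\sharp_{\mu_{i-1}}}a_{\mu_1\cdots\mu_k}\varphi^{\mu_k}\cdots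 d\varphi^{\mu_i}\cdots\varphi^{\mu_1},$$ with $d\varphi^{\mu}=0$ if $\sharp_\mu=1$; it satisfies $d^2=0$. *)

(* Defs.v *)
From HB Require Import structures.
From mathcomp Require Import all_boot all_order all_algebra.
From mathcomp Require Import generic_quotient ring_quotient.
From mathcomp Require Import boolp functions reals complex.

Set Implicit Arguments.
Unset Strict Implicit.
Unset Printing Implicit Defensive.

Import Order.TTheory GRing.Theory Num.Theory.

Local Open Scope ring_scope.

Record gradedSpace (K : fieldType) := GradedSpace {
  gspace :> lmodType K;
  gcomp : int -> submodClosed gspace;
  gcomp_span : forall v : gspace, exists (s : seq int) (w : int -> gspace),
    (forall n, w n \in gcomp n) /\ v = \sum_(n <- s) w n;
  gcomp_direct : forall (s : seq int) (w : int -> gspace), uniq s ->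
    (forall n, w n \in gcomp n) -> \sum_(n <- s) w n = 0 ->
    {in s, forall n, w n = 0} }.

Record homogBasis (K : fieldType) (H : gradedSpace K) := HomogBasis {
  bidx : choiceType;
  bvec : bidx -> H;
  bdeg : bidx -> int;
  bvec_homog : forall i, bvec i \in gcomp H (bdeg i);
  bvec_span : forall v : H, exists (s : seq bidx) (c : bidx -> K),
    v = \sum_(i <- s) c i *: bvec i;
  bvec_free : forall (s : seq bidx) (c : bidx -> K), uniq s ->
    \sum_(i <- s) c i *: bvec i = 0 -> {in s, forall i, c i = 0} }.

Section Words.
Variables (K : fieldType) (H : gradedSpace K) (b : homogBasis H).

Variant letter := Phi of bidx b | DPhi of bidx b.

Definition sharp (x : letter) : nat := if x is DPhi _ then 1%N else 0%N.

Definition lidx (x : letter) : bidx b :=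
  match x with Phi i => i | DPhi i => i end.

(* The degree of the basis vector e_i, not that of the coordinate phi^i
   (which is its opposite). *)
Definition ldeg (x : letter) : int := bdeg (lidx x).

(* [Word w] with [w : 'I_m.+1 -> letter] stands for the multi-index
   (mu_1, ..., mu_k), k = m.+1, i.e. for the monomial
   phi^{mu_k} ... phi^{mu_1}; [w ord0] is mu_1, the rightmost factor.
   The empty word is left out: there are no constant terms. *)
Record word := Word { wlen : nat; wlet :> 'I_wlen.+1 -> letter }.

Definition form_degree (w : word) : nat := (\sum_k sharp (w k))%N.

(* (mu_1, ..., mu_k) |-> (mu_2, ..., mu_k, mu_1) *)
Definition rotw (w : word) : word := Word (fun k => w (ordS k)).

Definition cyc_exponent (w : word) : int :=
  ldeg (w ord0) * (\sum_(k | k != ord0) ldeg (w k)) +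
  (sharp (w ord0) * \sum_(k | k != ord0) sharp (w k))%N%:Z.

Definition sharp_before (w : word) (i : 'I_(wlen w).+1) : nat :=
  (\sum_(j : 'I_(wlen w).+1 | (j < i)%N) sharp (w j))%N.

Definition set_letter (w : word) (i : 'I_(wlen w).+1) (x : letter) : word :=
  Word (fun j => if j == i then x else w j).

End Words.

Section WordTheory.
Variables (K : fieldType) (H : gradedSpace K) (b : homogBasis H).
Implicit Types w : word b.

Lemma set_letterC w (i j : 'I_(wlen w).+1) (x y : letter b) : i != j ->
  @set_letter _ _ _ (set_letter i x) j y = @set_letter _ _ _ (set_letter j y) i x.
Proof.
move=> ij; congr Word; apply/funext => k /=.
by case: eqVneq => // ->; rewrite eq_sym (negPf ij).
Qed.

Lemma form_degree_set w (i : 'I_(wlen w).+1) x : sharp (w i) = 1%N ->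
  form_degree w = (form_degree (set_letter i (Phi x))).+1.
Proof.
move=> wi; rewrite /form_degree (bigD1 i) //= wi [in RHS](bigD1 i) //= eqxx /=.
by rewrite add0n add1n; congr _.+1; apply: eq_bigr => k /negPf ->.
Qed.

Lemma sharp_before_set w (i j : 'I_(wlen w).+1) x : sharp (w i) = 1%N ->
  sharp_before j = (sharp_before (w := set_letter i (Phi x)) j + (i < j))%N.
Proof.
move=> wi; rewrite /sharp_before /=; case: (boolP (i < j)%N) => ij.
  rewrite (bigD1 i) //= wi [in RHS](bigD1 i) //= eqxx /= add0n addnC.
  by congr (_ + _)%N; apply: eq_bigr => k /andP[_ /negPf ->].
by rewrite addn0; apply: eq_bigr => k kj; case: eqP => // ki; rewrite -ki kj in ij.
Qed.

Lemma ldeg_set w i k :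
  ldeg ((set_letter i (Phi (lidx (w i)))) k) = ldeg (w k).
Proof. by rewrite /=; case: eqP => // ->. Qed.

Lemma rotw_set w (i : 'I_(wlen w).+1) x :
  set_letter (w := rotw w) i x = rotw (set_letter (ordS i) x).
Proof.
congr Word; apply/funext => k /=.
by rewrite (inj_eq (@ordS_inj _)).
Qed.

Lemma form_degree_rotw w : form_degree (rotw w) = form_degree w.
Proof.
by rewrite /form_degree /= [RHS](reindex (@ordS _)) //; apply/onW_bij/ordS_bij.
Qed.

End WordTheory.

Section Forms.
Variables (R : realType) (H : gradedSpace R[i]) (b : homogBasis H).
Implicit Types w : word b.

(* Formal sums of monomials: [F w] is the coefficient of the monomial w, so
   that F w = a_w / k with a_w = [acoef F w] for a word w of length k. *)
Local Notation series := (word b -> R[i]).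

Definition acoef (F : series) (w : word b) : R[i] := (wlen w).+1%:R * F w.

Definition cyclic_form (l : nat) : {pred series} := fun F =>
  `[< (forall w, acoef F w = (-1) ^ cyc_exponent w * acoef F (rotw w)) /\
      (forall w, form_degree w != l -> F w = 0) >].

Fact cyclic_form_submod l : submod_closed (cyclic_form l).
Proof.
split=> [|c F G /asboolP[cF dF] /asboolP[cG dG]]; apply/asboolP; split=> w.
- by rewrite /acoef !mulr0.
- by [].
- have E v : acoef (c *: F + G) v = c * acoef F v + acoef G v.
    by rewrite /acoef mulrCA -mulrDr.
  by rewrite !E cF cG mulrDr [in RHS]mulrCA.
- by move=> wl; rewrite !fctE dF // dG // scaler0 addr0.
Qed.

HB.instance Definition _ l :=
  GRing.isSubmodClosed.Build _ _ (cyclic_form l) (cyclic_form_submod l).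

Record cform (l : nat) := CForm
  { cform_val :> series; cformP : cform_val \in cyclic_form l }.

HB.instance Definition _ l := [isSub for @cform_val l].
HB.instance Definition _ l := [Choice of cform l by <:].
HB.instance Definition _ l := [SubChoice_isSubLmodule of cform l by <:].

(* Coefficient of the monomial v in dF: v arises from the monomials w obtained
   from v by turning back one factor v_i = dphi^j into phi^j; see
   [ext_d_monomial] for the effect on monomials. *)
Definition ext_d (F : series) : series := fun v =>
  \sum_(i | sharp (v i) == 1%N)
    (-1) ^+ sharp_before i * F (set_letter i (Phi (lidx (v i)))).

Definition monomial (w : word b) : series := fun v => `[< v = w >]%:R.

Lemma ext_d_monomial w v : ext_d (monomial w) v =
  \sum_(i | sharp (w i) == 0%N)
    (-1) ^+ sharp_before i * monomial (set_letter i (DPhi (lidx (w i)))) v.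
Proof.
rewrite /ext_d.
case: v => m v; case: w => n w /=.
have [mn|mn] := eqVneq m n; last first.
  rewrite !big1 // => i _; rewrite /monomial asboolF ?mulr0 //.
    by move=> e; move: mn; rewrite -[m]/(wlen (Word v)) e eqxx.
  move=> e.
  by move: mn; rewrite -[m]/(wlen (@set_letter _ _ _ (Word v) i (Phi (lidx (v i))))) e eqxx.
case: n / mn w => w.
have WI (u u' : 'I_m.+1 -> letter b) : (Word u = Word u') <-> u =1 u'.
  split=> [e i|/funext -> //].
  by have /= := congr1 (fun w : word b => w (inord i)) e; rewrite inord_val.
have E i : (sharp (v i) = 1%N /\ (set_letter (w := Word v) i (Phi (lidx (v i)))) = Word w)
   <-> (sharp (w i) = 0%N /\ Word v = (set_letter (w := Word w) i (DPhi (lidx (w i))))).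
  split=> -[si /WI e].
  - have wi : w i = Phi (lidx (v i)) by rewrite -e /= eqxx.
    split; first by rewrite wi.
    apply/WI => j /=; case: eqP => [->|ji].
      by rewrite wi /=; case: (v i) si.
    by rewrite -e /=; case: eqP.
  - have vi : v i = DPhi (lidx (w i)) by rewrite e /= eqxx.
    split; first by rewrite vi.
    apply/WI => j /=; case: eqP => [->|ji].
      by rewrite vi /=; case: (w i) si.
    by rewrite e /=; case: eqP.
rewrite big_mkcond [RHS]big_mkcond; apply: eq_bigr => i _ /=.
rewrite /monomial.
case: (pselect (sharp (v i) = 1%N /\
   (set_letter (w := Word v) i (Phi (lidx (v i)))) = Word w)) => [vw|vw].
  have [wi ew] := (E i).1 vw; case: vw => vi ev.
  rewrite vi wi !eqxx !asboolT // !mulr1; congr (_ ^+ _).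
  rewrite /sharp_before /=; apply: eq_bigr => j ji.
  move/WI: ew => ->; rewrite /=; case: eqP => // e.
  by rewrite e ltnn in ji.
rewrite [LHS](_ : _ = 0); last first.
  case: eqP => // vi; rewrite asboolF ?mulr0 // => e.
  by apply: vw.
case: eqP => // wi; rewrite asboolF ?mulr0 // => e.
by apply: vw; apply/E.
Qed.

Lemma acoef_cyclic F w :
  (acoef F w = (-1) ^ cyc_exponent w * acoef F (rotw w)) <->
  (F w = (-1) ^ cyc_exponent w * F (rotw w)).
Proof.
rewrite /acoef /= mulrCA; split=> [|-> //].
by apply: mulfI; rewrite pnatr_eq0.
Qed.


Lemma cyc_exponent_parity w : (-1) ^ cyc_exponent w =
  (-1) ^ (ldeg (w ord0) * (\sum_(k | k != ord0) ldeg (w k))) *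
  (-1) ^+ (sharp (w ord0) * \sum_(k | k != ord0) sharp (w k))%N :> R[i].
Proof. by rewrite /cyc_exponent expfzDr // oppr_eq0 oner_eq0. Qed.

(* The sign identity behind the compatibility of d with cyclic symmetry. *)
Lemma cyc_sign_ext_d w (i : 'I_(wlen w).+1) :
  sharp (w (ordS i)) = 1%N ->
  (-1) ^ cyc_exponent w * (-1) ^+ sharp_before (w := rotw w) i =
  (-1) ^+ sharp_before (w := w) (ordS i) *
  (-1) ^ cyc_exponent (set_letter (ordS i) (Phi (lidx (w (ordS i))))) :> R[i].
Proof.
move=> wi; rewrite !cyc_exponent_parity !ldeg_set.
under [X in _ = _ * (_ ^ (_ * X) * _)]eq_bigr do rewrite ldeg_set.
rewrite -mulrA [RHS]mulrCA; congr (_ * _).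
rewrite -!exprD -signr_odd -[RHS]signr_odd; congr (_ ^+ nat_of_bool _).
case: w i wi => m w /= i wi.
rewrite /sharp_before /=.
have ordS_widen (j : 'I_m) : ordS (widen_ord (leqnSn m) j) = lift ord0 j.
  by apply: val_inj; rewrite /= modn_small // ltnS.
have sN0 (f : 'I_m.+1 -> nat) :
    (\sum_(k | k != ord0) f k = \sum_(k < m) f (lift ord0 k))%N.
  by rewrite big_mkcond big_ord_recl /= add0n.
have sS : (\sum_(j < m.+1 | j < i) sharp (w (ordS j)) =
           \sum_(j < m | j < i) sharp (w (lift ord0 j)))%N.
  rewrite big_mkcond big_ord_recr /= ltnNge -ltnS ltn_ord addn0 -big_mkcond /=.
  by apply: eq_bigr => j _; rewrite ordS_widen.
rewrite {}sS !sN0 -[(i.+1 %% _)%N]/(nat_of_ord (ordS i)).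
have [im|im] := eqVneq (i : nat) m.
  have i0 : ordS i = ord0 by apply: val_inj; rewrite /= im modnn.
  rewrite i0 in wi *; rewrite wi mul1n eqxx mul0n addn0 [in RHS]big_pred0 //.
  rewrite [X in (_ + X)%N](eq_bigl xpredT) => [|j]; last by rewrite im ltn_ord.
  by rewrite addnn odd_double.
have {}im : (i < m)%N by rewrite ltn_neqAle im -ltnS ltn_ord.
have iS : ordS i = lift ord0 (Ordinal im).
  by apply: val_inj; rewrite /= modn_small.
rewrite iS in wi *.
rewrite [X in (_ = odd (X + _))%N]big_mkcond big_ord_recl /= -big_mkcond /=.
rewrite (bigD1 (Ordinal im)) //= wi [X in (_ = odd (_ + _ * X))%N](bigD1 (Ordinal im)) //=.
rewrite eqxx add0n /= [X in (_ = odd (_ + _ * X))%N](eq_bigr (fun k => sharp (w (lift ord0 k)))).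
  by rewrite mulnDr muln1 addnAC.
by move=> k /negPf ki; rewrite (inj_eq lift_inj) ki.
Qed.

Lemma ext_d_cyclic l F : F \in cyclic_form l -> ext_d F \in cyclic_form l.+1.
Proof.
move=> /asboolP[cF dF]; apply/asboolP; split=> w; last first.
  move=> wl; rewrite /ext_d big1 // => i /eqP wi; rewrite dF ?mulr0 //.
  by rewrite (form_degree_set (lidx (w i)) wi) eqSS in wl.
apply/acoef_cyclic; rewrite /ext_d mulr_sumr.
rewrite [LHS](reindex (@ordS _)) /=; last exact/onW_bij/ordS_bij.
apply: eq_bigr => i /eqP wi; rewrite mulrA cyc_sign_ext_d // -mulrA.
congr (_ * _); rewrite rotw_set.
exact/acoef_cyclic.
Qed.

Lemma ext_d_sq F : ext_d (ext_d F) = 0.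
Proof.
apply/funext => w.
pose G (i j : 'I_(wlen w).+1) : R[i] :=
  (-1) ^+ sharp_before (w := w) i * ((-1) ^+ sharp_before
     (w := set_letter i (Phi (lidx (w i)))) j * 
   F (@set_letter _ _ _ (set_letter i (Phi (lidx (w i)))) j (Phi (lidx (w j))))).
pose P i j := [&& sharp (w i) == 1%N, sharp (w j) == 1%N & i != j].
have dd : ext_d (ext_d F) w = \sum_i \sum_(j | P i j) G i j.
  rewrite /ext_d big_mkcond /=; apply: eq_bigr => i _.
  rewrite /P; case: eqP => wi; last by rewrite big_pred0.
  rewrite mulr_sumr; apply: eq_big => [j|j] /=.
    by rewrite [i == j]eq_sym; case: (j == i); rewrite ?andbF ?andbT.
  by rewrite /G; case: (j == i).
have GN i j : P i j -> G i j = - G j i.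
  case/and3P=> /eqP wi /eqP wj ij; rewrite /G (set_letterC _ _ ij) !mulrA.
  rewrite -mulNr; congr (_ * _); rewrite -!exprD -[RHS]mulN1r -exprS.
  rewrite -signr_odd -[RHS]signr_odd; congr (_ ^+ nat_of_bool _).
  rewrite (sharp_before_set i (lidx (w j)) wj) (sharp_before_set j (lidx (w i)) wi).
  rewrite /= !oddD; move: ij; rewrite -val_eqE neq_ltn.
  by case: ltngtP => //= _ _; do 2!case: odd.
have ddN : ext_d (ext_d F) w = - ext_d (ext_d F) w.
  rewrite {2}dd (exchange_big_dep xpredT) //= dd -sumrN; apply: eq_bigr => i _.
  rewrite -sumrN; apply: eq_big => j; last exact: GN.
  by rewrite /P [i == j]eq_sym andbCA.
by apply/eqP; move/eqP: ddN; rewrite -addr_eq0 -mulr2n mulrn_eq0.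
Qed.

Fact ext_d_form_subproof l (F : cform l) : ext_d F \in cyclic_form l.+1.
Proof. exact: ext_d_cyclic (cformP F). Qed.

Definition ext_d_form l (F : cform l) : cform l.+1 :=
  CForm (ext_d_form_subproof F).

Fact ext_d_form_linear l : linear (@ext_d_form l).
Proof.
move=> c F G; apply/val_inj/funext => v /=.
rewrite /ext_d !fctE /ext_d /GRing.scale /= mulr_sumr -big_split /=.
by apply: eq_bigr => i _; rewrite mulrDr [in LHS]mulrCA.
Qed.

HB.instance Definition _ l :=
  GRing.isLinear.Build _ _ _ _ (@ext_d_form l) (@ext_d_form_linear l).

Lemma ext_d_form_sq l (F : cform l) : ext_d_form (ext_d_form F) = 0.
Proof. exact/val_inj/ext_d_sq. Qed.

Definition closed_form (l : nat) : {pred cform l} :=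
  fun F => ext_d_form F == 0.

Fact closed_form_submod l : submod_closed (@closed_form l).
Proof.
split=> [|c F G]; rewrite !unfold_in /closed_form ?linear0 //.
by move=> /eqP F0 /eqP G0; rewrite linearP /= F0 G0 scaler0 addr0.
Qed.

HB.instance Definition _ l :=
  GRing.isSubmodClosed.Build _ _ (@closed_form l) (closed_form_submod l).

Record cocycle (l : nat) := Cocycle
  { cocycle_val :> cform l; cocycleP : cocycle_val \in @closed_form l }.

HB.instance Definition _ l := [isSub for @cocycle_val l].
HB.instance Definition _ l := [Choice of cocycle l by <:].
HB.instance Definition _ l := [SubChoice_isSubLmodule of cocycle l by <:].

(* The image of d among the cocycles; there are no forms of degree -1. *)
Definition exact_form (l : nat) : {pred cocycle l} :=
  match l with
  | 0 => fun Z => Z == 0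
  | l'.+1 => fun Z => `[< exists F : cform l', cocycle_val Z = ext_d_form F >]
  end.

Fact exact_form_submod l : submod_closed (@exact_form l).
Proof.
case: l => [|l]; split=> [|c F G]; rewrite ?unfold_in //=.
- by move=> /eqP-> /eqP->; rewrite scaler0 addr0.
- by apply/asboolP; exists 0; rewrite linear0.
move=> /asboolP[F' FE] /asboolP[G' GE]; apply/asboolP; exists (c *: F' + G').
by rewrite linearP /= -FE -GE.
Qed.

HB.instance Definition _ l :=
  GRing.isSubmodClosed.Build _ _ (@exact_form l) (exact_form_submod l).

Definition cohomology (l : nat) : zmodType := Quotient.quot (@exact_form l).

Lemma cohomology_eq0P l :
  (forall x : cohomology l, x = 0) <-> (forall Z : cocycle l, Z \in @exact_form l).
Proof.
have E (Z : cocycle l) :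
    (Z \in @exact_form l) = ((\pi_(cohomology l) Z)%qT == 0).
  by rewrite -[Z in LHS]subr0 Quotient.idealrBE raddf0.
split=> [H0 Z|H0 x]; first by rewrite E; apply/eqP/H0.
by rewrite -[x]reprK; apply/eqP; rewrite -E.
Qed.

End Forms.

(* Main.v *)
Require Import Defs.
From HB Require Import structures.
From mathcomp Require Import all_boot all_order all_algebra.
From mathcomp Require Import boolp functions reals complex.

(** The proof is the algebraic Poincare lemma.  Dually to the derivation d, which
    sends phi^i to dphi^i, let h be the derivation, odd for the form degree,
    which sends dphi^i to phi^i and kills phi^i: it is the contraction with the
    Euler vector field.  The graded commutator dh + hd is then the even derivation
    that fixes every letter, so it multiplies a word of length k by k
    ([ext_d_contract]); no cyclic symmetry is involved there.

    As phi^i and dphi^i have the same degree, h has to respect the cyclic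
    symmetry for the same reason as d does ([contract_cyclic]); its sign identity
    even follows formally from the one for d.  There are no constant terms, so
    every length k is invertible, and a closed form F is d of (1/k) h F.  In form
    degree 0 there is no dphi to contract, so h F = 0 and F itself vanishes. *)

Set Implicit Arguments.
Unset Strict Implicit.
Unset Printing Implicit Defensive.

Import Order.TTheory GRing.Theory Num.Theory.

Local Open Scope ring_scope.

Section Letters.
Variables (K : fieldType) (H : gradedSpace K) (b : homogBasis H).
Implicit Types w : word b.

Lemma set_letter_id w (i : 'I_(wlen w).+1) x : w i = x -> set_letter i x = w.
Proof.
case: w i => m w /= i wi; congr Word; apply/funext => j /=.
by case: eqP => // ->.
Qed.

Lemma set_letter_set w (i : 'I_(wlen w).+1) x y :
  @set_letter _ _ _ (set_letter i x) i y = set_letter i y.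
Proof. by congr Word; apply/funext => j /=; case: eqP. Qed.

Lemma sharp0_Phi (x : letter b) : sharp x = 0%N -> x = Phi (lidx x).
Proof. by case: x. Qed.

Lemma sharp1_DPhi (x : letter b) : sharp x = 1%N -> x = DPhi (lidx x).
Proof. by case: x. Qed.

Lemma sharp_neq1 (x : letter b) : (sharp x != 1%N) = (sharp x == 0%N).
Proof. by case: x. Qed.

Lemma sharp_before_set_same w (i : 'I_(wlen w).+1) x :
  sharp_before (w := set_letter i x) i = sharp_before i.
Proof.
by apply: eq_bigr => j; case: (eqVneq j i) => [->|/negPf /= -> //]; rewrite ltnn.
Qed.

Lemma set_letter_PhiK w (i : 'I_(wlen w).+1) x : sharp (w i) = 0%N ->
  @set_letter _ _ _ (set_letter i x) i (Phi (lidx (w i))) = w.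
Proof. by move=> wi; rewrite set_letter_set set_letter_id // -sharp0_Phi. Qed.

Lemma set_letter_DPhiK w (i : 'I_(wlen w).+1) x : sharp (w i) = 1%N ->
  @set_letter _ _ _ (set_letter i x) i (DPhi (lidx (w i))) = w.
Proof. by move=> wi; rewrite set_letter_set set_letter_id // -sharp1_DPhi. Qed.

Lemma form_degree_set_DPhi w (i : 'I_(wlen w).+1) : sharp (w i) = 0%N ->
  form_degree (set_letter i (DPhi (lidx (w i)))) = (form_degree w).+1.
Proof.
move=> wi; set w' := set_letter _ _.
have w'i : sharp (w' i) = 1%N by rewrite /= eqxx.
by rewrite (form_degree_set (w := w') (lidx (w i)) w'i) set_letter_PhiK.
Qed.

Lemma sharp_before_set_DPhi w (i j : 'I_(wlen w).+1) : sharp (w i) = 0%N ->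
  sharp_before (w := set_letter i (DPhi (lidx (w i)))) j =
  (sharp_before j + (i < j))%N.
Proof.
move=> wi; set w' := set_letter _ _.
have w'i : sharp (w' i) = 1%N by rewrite /= eqxx.
rewrite (sharp_before_set (w := w') j (lidx (w i)) w'i); congr (_ + _)%N.
by apply: eq_bigr => k _ /=; case: eqP => // ->; rewrite wi.
Qed.

End Letters.

Section Contraction.
Variables (R : realType) (H : gradedSpace R[i]) (b : homogBasis H).
Implicit Types (w : word b) (F : word b -> R[i]).

(** The contraction h with the Euler vector field, read on coefficients: under h,
    the monomial v arises from those in which one factor phi^j of v is still
    dphi^j. *)
Definition contract F : word b -> R[i] := fun v =>
  \sum_(i | sharp (v i) == 0%N)
    (-1) ^+ sharp_before i * F (set_letter i (DPhi (lidx (v i)))).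

(** Both sides of the identity are signs, and turning the letter into dphi swaps
    the two words of [cyc_sign_ext_d]: this is that identity for the new word,
    with the two cyclic signs moved to the other side. *)
Lemma cyc_sign_contract w (i : 'I_(wlen w).+1) : sharp (w (ordS i)) = 0%N ->
  (-1) ^ cyc_exponent w * (-1) ^+ sharp_before (w := rotw w) i =
  (-1) ^+ sharp_before (w := w) (ordS i) *
  (-1) ^ cyc_exponent (set_letter (ordS i) (DPhi (lidx (w (ordS i))))) :> R[i].
Proof.
move=> wi; set w' := set_letter _ _.
have w'i : sharp (w' (ordS i)) = 1%N by rewrite /= eqxx.
have := @cyc_sign_ext_d R H b w' i w'i.
have -> : lidx (w' (ordS i)) = lidx (w (ordS i)) by rewrite /= eqxx.
rewrite set_letter_PhiK // sharp_before_set_same.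
have -> : sharp_before (w := rotw w') i = sharp_before (w := rotw w) i.
  apply: eq_bigr => j ji /=; rewrite (inj_eq (@ordS_inj _)).
  by case: (eqVneq j i) ji => [->|//]; rewrite ltnn.
have sq (n : int) : ((-1) ^ n * (-1) ^ n = 1 :> R[i]).
  by rewrite -expfzMl mulrNN mulr1 exp1rz.
move=> E; rewrite -[LHS]mul1r -[X in X * _](sq (cyc_exponent w')) mulrACA E.
by rewrite mulrACA sq mulr1 mulrC.
Qed.

Lemma contract_cyclic l F :
  F \in cyclic_form l.+1 -> contract F \in cyclic_form l.
Proof.
move=> /asboolP[cF dF]; apply/asboolP; split=> w; last first.
  move=> wl; rewrite /contract big1 // => i /eqP wi; rewrite dF ?mulr0 //.
  by rewrite form_degree_set_DPhi.
apply/acoef_cyclic; rewrite /contract mulr_sumr.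
rewrite [LHS](reindex (@ordS _)) /=; last exact/onW_bij/ordS_bij.
apply: eq_bigr => i /eqP wi; rewrite mulrA cyc_sign_contract // -mulrA.
by congr (_ * _); rewrite rotw_set; apply/acoef_cyclic.
Qed.

Lemma contract_form_degree0 F : F \in cyclic_form 0 -> contract F = 0.
Proof.
move=> /asboolP[_ dF]; apply/funext => w; apply: big1 => i /eqP wi.
by rewrite dF ?mulr0 // form_degree_set_DPhi.
Qed.

(** Cartan's formula for the Euler field.  Acting twice on the same letter gives
    back F, once per letter; acting on two different letters, the two orders
    differ by the sign of exchanging two odd operators. *)
Lemma ext_d_contract F w :
  ext_d (contract F) w + contract (ext_d F) w = (wlen w).+1%:R * F w.
Proof.
pose D (i : 'I_(wlen w).+1) := sharp (w i) == 1%N.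
pose toPhi (i : 'I_(wlen w).+1) := set_letter i (Phi (lidx (w i))).
pose toDPhi (i : 'I_(wlen w).+1) := set_letter i (DPhi (lidx (w i))).
(* i is the letter dphi turned into phi, j the letter phi turned into dphi. *)
pose G i j : R[i] := (-1) ^+ sharp_before (w := w) i *
  ((-1) ^+ sharp_before (w := toPhi i) j *
   F (@set_letter _ _ _ (toPhi i) j (DPhi (lidx (w j))))).
have dh : ext_d (contract F) w =
    \sum_(i | D i) F w + \sum_(i | D i) \sum_(j | ~~ D j) G i j.
  rewrite -big_split; apply: eq_bigr => i /eqP wi.
  rewrite /contract (bigD1 i) /= ?eqxx // mulrDr; congr (_ + _).
    by rewrite set_letter_DPhiK // sharp_before_set_same signrMK.
  rewrite mulr_sumr; apply: eq_big => [j|j /andP[_ /negPf ji]].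
    by rewrite /D sharp_neq1; case: (eqVneq j i) => [->|]; rewrite ?wi ?andbF ?andbT.
  by rewrite ji.
have hd : contract (ext_d F) w =
    \sum_(j | ~~ D j) F w - \sum_(i | D i) \sum_(j | ~~ D j) G i j.
  rewrite (exchange_big_dep (fun j => ~~ D j)) //= -sumrB.
  apply: eq_big => [j|j /eqP wj]; first by rewrite /D sharp_neq1.
  rewrite /ext_d (bigD1 j) /= ?eqxx // mulrDr; congr (_ + _).
    by rewrite set_letter_PhiK // sharp_before_set_same signrMK.
  rewrite mulr_sumr -sumrN; apply: eq_big => [i|i /andP[wi ji]].
    by rewrite /D; case: (eqVneq i j) => [->|]; rewrite ?wj ?andbF ?andbT.
  rewrite (negPf ji) in wi *; move/eqP in wi.
  rewrite /G /toPhi set_letterC // !mulrA -mulNr; congr (_ * _).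
  rewrite sharp_before_set_DPhi // (sharp_before_set j (lidx (w i)) wi).
  rewrite -!exprD -[RHS]mulN1r -exprS.
  rewrite -signr_odd -[RHS]signr_odd; congr (_ ^+ nat_of_bool _).
  rewrite /= !oddD; move: ji; rewrite -val_eqE neq_ltn.
  by case: ltngtP => //= _ _; do 2!case: odd.
rewrite dh hd addrACA subrr addr0.
by rewrite -(bigID D xpredT) /= sumr_const card_ord mulr_natl.
Qed.

(** The inverse of the Euler number operator dh + hd. *)
Definition inv_length F : word b -> R[i] := fun w => (wlen w).+1%:R^-1 * F w.

Lemma inv_length_cyclic l F :
  F \in cyclic_form l -> inv_length F \in cyclic_form l.
Proof.
move=> /asboolP[cF dF]; apply/asboolP; split=> w; last first.
  by move=> wl; rewrite /inv_length dF ?mulr0.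
by apply/acoef_cyclic; rewrite /inv_length (acoef_cyclic _ _).1 //= mulrCA.
Qed.

Lemma ext_d_inv_length F : ext_d (inv_length F) = inv_length (ext_d F).
Proof.
apply/funext => w; rewrite /ext_d /inv_length mulr_sumr.
by apply: eq_bigr => i _; rewrite mulrCA.
Qed.

Lemma closed_eq_ext_d F :
  ext_d F = 0 -> F = ext_d (inv_length (contract F)).
Proof.
move=> dF; rewrite ext_d_inv_length; apply/funext => w.
have := ext_d_contract F w.
have -> : contract (ext_d F) w = 0.
  by rewrite dF; apply: big1 => i _; rewrite mulr0.
by rewrite addr0 /inv_length => ->; rewrite mulKf // pnatr_eq0.
Qed.

Lemma cocycle_exact l (Z : cocycle b l) : Z \in @exact_form _ _ b l.
Proof.
have dZ : ext_d Z = 0 by have /eqP/(congr1 val) := cocycleP Z.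
have ZE := closed_eq_ext_d dZ.
case: l Z dZ ZE => [|l] Z _ ZE.
  apply/eqP/val_inj/val_inj; rewrite /= ZE contract_form_degree0 ?cformP //.
  by apply/funext => w; apply: big1 => i _; rewrite /inv_length !mulr0.
apply/asboolP.
exists (CForm (inv_length_cyclic (contract_cyclic (cformP Z)))).
exact: val_inj.
Qed.

End Contraction.

Theorem lemma4p8 (R : realType) (H : gradedSpace R[i]) (b : homogBasis H)
  (l : nat) (x : cohomology b l) : x = 0.
Proof. exact: ((cohomology_eq0P b l).2 (@cocycle_exact R H b l)). Qed.
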